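(* Let $n,m,l\in\mathbb N^*$ and let $k\in\mathbb N^*$. Let $A_{k-1}\in\mathbb R^{n\times n}$, $B_{k-1}\in\mathbb R^{n\times l}$, $R_{k-1}=[\boldsymbol r_{{k-1}_1},\dots,\boldsymbol r_{{k-1}_m}]\in\mathbb R^{n\times m}$, $\boldsymbol\tau_{k-1}\in\mathbb R^l$, $\hat{\boldsymbol x}_{k-1}\in\mathbb R^n$, $\varsigma_{k-1}>0$ and $P_{k-1}\in\mathbb R^{n\times n}$ symmetric positive semi-definite. Suppose $\boldsymbol x_{k-1}\in\mathcal E(\hat{\boldsymbol x}_{k-1},\varsigma_{k-1}P_{k-1})$ and $$\boldsymbol x_k=A_{k-1}\boldsymbol x_{k-1}+B_{k-1}\boldsymbol\tau_{k-1}+R_{k-1}\boldsymbol\nu_{k-1}\quad\text{with}\quad \boldsymbol\nu_{k-1}\in[-1,1]^m .$$ For $\boldsymbol\mu=(\mu_1,\dots,\mu_m)^T\in(0,\infty)^m$ define $\hat{\boldsymbol x}_{k/k-1}:=A_{k-1}\hat{\boldsymbol x}_{k-1}+B_{k-1}\boldsymbol\tau_{k-1}$, $P_{k/k-1_0}:=A_{k-1}P_{k-1}A_{k-1}^T$, and for $i\in\{1,\dots,m\}$ $$P_{k/k-1_i}:=(1+\mu_i)P_{k/k-1_{i-1}}+\frac{1+\mu_i}{\mu_i\,\varsigma_{k-1}}\,\boldsymbol r_{{k-1}_i}\boldsymbol r_{{k-1}_i}^T,$$ $P_{k/k-1}:=P_{k/k-1_m}$ and $\mathcal E_{k/k-1_i}:=\mathcal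 E(\hat{\boldsymbol x}_{k/k-1},\varsigma_{k-1}P_{k/k-1_i})$ for $i\in\{0,\dots,m\}$. Then, for every $\boldsymbol\mu\in(0,\infty)^m$, $$\boldsymbol x_k\in\mathcal E(\hat{\boldsymbol x}_{k/k-1},\varsigma_{k-1}P_{k/k-1})=\mathcal E_{k/k-1_m}\supseteq\mathcal E_{k/k-1_{m-1}}\supseteq\dots\supseteq\mathcal E_{k/k-1_0}.$$
   Context: For $\boldsymbol c\in\mathbb R^n$ and $P\in\mathbb R^{n\times n}$ symmetric positive semi-definite, $\mathcal E(\boldsymbol c,P):=\{\boldsymbol c+P^{1/2}\boldsymbol z:\ \boldsymbol z\in\mathbb R^n,\ \|\boldsymbol z\|_2\le 1\}$ is the (possibly degenerate) ellipsoid of center $\boldsymbol c$ and shape matrix $P$; when $P$ is positive definite this equals $\{\boldsymbol x:(\boldsymbol x-\boldsymbol c)^TP^{-1}(\boldsymbol x-\boldsymbol c)\le 1\}$. *)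

(* Defs.v *)
From HB Require Import structures.
From mathcomp Require Import all_boot all_order all_algebra.
From mathcomp Require Import boolp classical_sets reals.
Set Implicit Arguments.
Unset Strict Implicit.
Unset Printing Implicit Defensive.
Import Order.TTheory GRing.Theory Num.Theory.
Local Open Scope classical_set_scope.
Local Open Scope ring_scope.

(* The norm `|z| that MathComp-Analysis puts on matrices is the sup norm,
   hence an explicit Euclidean norm. *)
Definition norm2 (R : realType) (n : nat) (z : 'cV[R]_n) : R :=
  Num.sqrt (\sum_(i < n) z i ord0 ^+ 2).

Definition psdmx (R : realType) (n : nat) (P : 'M[R]_n) : Prop :=
  P^T = P /\ forall v : 'cV[R]_n, 0 <= (v^T *m P *m v) ord0 ord0.

(* P^{1/2}: for symmetric positive semi-definite P there is exactly one
   symmetric positive semi-definite S with S S = P, so the choice is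
   unambiguous there; the default value 0 is only returned for other P. *)
Definition sqrtmx (R : realType) (n : nat) (P : 'M[R]_n) : 'M[R]_n :=
  xget 0 [set S : 'M[R]_n | psdmx S /\ S *m S = P].

Definition ellipsoid (R : realType) (n : nat) (c : 'cV[R]_n) (P : 'M[R]_n) :
    set 'cV[R]_n :=
  [set c + sqrtmx P *m z | z in [set z : 'cV[R]_n | norm2 z <= 1]].

(* The i-th iterate of the shape recursion started at P0. Step i.+1 uses the
   (0-based) column i of G and entry i of mu, which are the (i+1)-st ones in
   1-based numbering. For i < m, insub i = Some j with j = i :> nat; the None
   branch is reached only beyond m steps. *)
Fixpoint pred_shape (R : realType) (n m : nat) (P0 : 'M[R]_n) (G : 'M[R]_(n, m))
    (sigma : R) (mu : 'cV[R]_m) (i : nat) : 'M[R]_n :=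
  if i is i'.+1 then
    let Q := pred_shape P0 G sigma mu i' in
    if insub i' is Some j then
      (1 + mu j ord0) *: Q
      + ((1 + mu j ord0) / (mu j ord0 * sigma)) *: (col j G *m (col j G)^T)
    else Q
  else P0.

(* Main.v *)
(* For positive semi-definite P, a point x lies in the ellipsoid of center c and
   shape P iff (v . (x - c))^2 <= v^T P v for every v. In these terms one step
   of the recursion is (a + b)^2 <= (1 + mu) a^2 + (1 + 1/mu) b^2, with
   b = nu_i (v . r_i), and the nesting is q <= (1 + mu) q + (a square). The
   converse half of the criterion only needs some symmetric square root S of P,
   since x - c = P w = S (S w) when x - c is orthogonal to the kernel of P. *)
Require Import Defs.
From HB Require Import structures.
From mathcomp Require Import all_boot all_order all_algebra.
From mathcomp Require Import boolp classical_sets reals.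
From mathcomp Require Import complex.
From mathcomp Require Import ring lra.
Set Implicit Arguments.
Unset Strict Implicit.
Unset Printing Implicit Defensive.
Import Order.TTheory GRing.Theory Num.Theory.
Local Open Scope classical_set_scope.
Local Open Scope ring_scope.

(** * Square roots of positive semi-definite matrices, by polynomial calculus *)

(** Newton interpolation: a new node is corrected by a multiple of the product vanishing on [s],
    which keeps the old values. Repeated nodes are harmless, so [s] may list eigenvalues with
    multiplicity. *)
Lemma poly_interpolation (K : fieldType) (f : K -> K) (s : seq K) :
  exists q : {poly K}, {in s, forall x, q.[x] = f x}.
Proof.
elim: s => [|x s [q qP]]; first by exists 0.
have [xs|xNs] := boolP (x \in s).
  by exists q => y; rewrite inE => /predU1P[->|]; apply: qP.
pose p := \prod_(y <- s) ('X - y%:P).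
have px : p.[x] != 0 by rewrite -[_ == _]/(root p x) root_prod_XsubC.
exists (q + ((f x - q.[x]) / p.[x]) *: p) => y.
rewrite !hornerE inE => /predU1P[->|ys]; first by rewrite divfK // addrC subrK.
have /rootP-> : root p y by rewrite root_prod_XsubC.
by rewrite mulr0 addr0 qP.
Qed.

Lemma trmx_horner_mx (K : comNzRingType) n (A : 'M[K]_n.+1) (q : {poly K}) :
  (horner_mx A q)^T = horner_mx A^T q.
Proof.
elim/poly_ind: q => [|q c IH]; first by rewrite !rmorph0 trmx0.
rewrite !rmorphD !rmorphM /= !horner_mx_X !horner_mx_C linearD /= tr_scalar_mx.
rewrite trmx_mul IH; congr (_ + _).
exact: (comm_mx_horner q (erefl : comm_mx A^T A^T)).
Qed.

Lemma psd_eigenvalue_ge0 (R : realType) n (P : 'M[R]_n) (a : R) :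
  psdmx P -> eigenvalue P a -> 0 <= a.
Proof.
move=> [_ Ppos] /eigenvalueP[v vP v_neq0].
have := Ppos v^T; rewrite trmxK vP -scalemxAl mxE.
have -> : (v *m v^T) ord0 ord0 = \sum_j v ord0 j ^+ 2.
  by rewrite mxE; apply: eq_bigr => j _; rewrite mxE expr2.
rewrite pmulr_lge0 // lt_def sumr_ge0 ?andbT => [|j _]; last exact: sqr_ge0.
apply: contra v_neq0; rewrite psumr_eq0 => [/allP v0|j _]; last exact: sqr_ge0.
apply/eqP/rowP => j; have := v0 j (mem_index_enum j).
by rewrite sqrf_eq0 mxE => /eqP.
Qed.

(** Over [R[i]] a real symmetric matrix is Hermitian, hence normal and diagonalizable; a Hermitian
    spectrum is real, so [d] can be taken in [R]. *)
Lemma map_mx_symmetric_spectral (R : realType) n (P : 'M[R]_n) : P^T = P ->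
  exists (U : 'M[R[i]]_n) (d : 'rV[R]_n), U \in unitmx /\
    map_mx (real_complex R) P = invmx U *m diag_mx (map_mx (real_complex R) d) *m U.
Proof.
move=> Psym; set Pc := map_mx _ P.
have Pherm : Pc \is hermsymmx.
  apply: realsym_hermsym.
    by apply/is_hermitianmxP; rewrite expr0 scale1r map_mx_id // map_trmx Psym.
  by apply/mxOverP => i j; rewrite mxE; apply/complex_realP; eexists.
exists (spectralmx Pc), (map_mx (@complex.Re R) (spectral_diag Pc)).
split; first exact: spectral_unit.
have -> : map_mx (real_complex R) (map_mx (@complex.Re R) (spectral_diag Pc))
    = spectral_diag Pc.
  apply/rowP => j; rewrite 2!mxE RRe_real //.
  by have /mxOverP := hermitian_spectral_diag_real Pherm.
by have /hermitian_normalmx/orthomx_spectralP := Pherm.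
Qed.

Lemma trmx_mul_self_ge0 (R : realType) m n (B : 'M[R]_(m, n)) (v : 'cV[R]_n) :
  0 <= (v^T *m (B^T *m B) *m v) ord0 ord0.
Proof.
rewrite mulmxA -mulmxA -trmx_mul mxE sumr_ge0 // => j _.
by rewrite mxE -expr2 sqr_ge0.
Qed.

(* Diagonalizing P over R[i] and interpolating the fourth roots of its (real,
   non-negative) eigenvalues gives a real polynomial q with q(P)^4 = P. Then
   q(P)^2 is a real square root of P, and it is positive semi-definite because
   q(P) is symmetric: no spectral theorem over R is needed. *)
Lemma psd_sqrt_exists (R : realType) n (P : 'M[R]_n) : psdmx P ->
  exists S, psdmx S /\ S *m S = P.
Proof.
(* [horner_mx] needs a positive dimension. *)
case: n P => [|n] P Ppsd.
  by exists P; split => //; apply/matrixP => -[].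
have [U [d [Uunit PE]]] := map_mx_symmetric_spectral (proj1 Ppsd).
have d_ge0 j : 0 <= d ord0 j.
  apply: (psd_eigenvalue_ge0 Ppsd).
  rewrite -(eigenvalue_map (real_complex R)); apply/eigenvalueP.
  (* Since [U P = diag(d) U], row [j] of [U] is a left eigenvector for [d_j]; it is nonzero because
     [U] is invertible. *)
  exists (row j U); last first.
    apply: contraTneq Uunit => Uj0; rewrite unitmxE (expand_det_row _ j) big1.
      by rewrite unitr0.
    by move=> i _; have /rowP/(_ i) := Uj0; rewrite !mxE => ->; rewrite mul0r.
  rewrite PE -row_mul !mulmxA mulmxV // mul1mx.
  by apply/rowP => i; rewrite mul_diag_mx !mxE.
have [q qP] := poly_interpolation (fun a => Num.sqrt (Num.sqrt a))
  [seq d ord0 j | j : 'I_n.+1].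
pose T := horner_mx P q.
have Tsym : T^T = T by rewrite trmx_horner_mx (proj1 Ppsd).
exists (T *m T); split.
  split=> [|v]; first by rewrite trmx_mul Tsym.
  by rewrite -[X in X *m T]Tsym trmx_mul_self_ge0.
rewrite mulmxA.
have -> : T *m T *m T *m T = horner_mx P (q ^+ 4).
  by rewrite rmorphXn /= !exprS expr0 mulr1 -!mulmxE !mulmxA.
apply: (map_mx_inj (f := real_complex R)).
have -> : map_mx (real_complex R) (horner_mx P (q ^+ 4)) =
    invmx U *m diag_mx (map_mx (real_complex R) (map_mx (horner (q ^+ 4)) d)) *m U.
  rewrite map_horner_mx PE (horner_mx_uconjC _ _ Uunit) horner_mx_diag.
  by rewrite -!map_mx_comp (eq_map_mx _ (horner_map _ _)).
have -> : map_mx (horner (q ^+ 4)) d = d.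
  apply/rowP => j; rewrite mxE horner_exp qP ?map_f ?mem_enum //.
  by rewrite (exprM _ 2 2) sqr_sqrtr ?sqrtr_ge0 // sqr_sqrtr.
by rewrite PE.
Qed.

(** * Quadratic forms and the directional criterion for ellipsoids *)

Definition quad (R : realType) n (P : 'M[R]_n) (v : 'cV[R]_n) : R :=
  (v^T *m P *m v) ord0 ord0.

Section Quad.
Context {R : realType} {n : nat}.
Implicit Types (P Q : 'M[R]_n) (u v w z c x r : 'cV[R]_n).

Lemma quadD P Q v : quad (P + Q) v = quad P v + quad Q v.
Proof. by rewrite /quad mulmxDr mulmxDl [LHS]mxE. Qed.

Lemma quadZ a P v : quad (a *: P) v = a * quad P v.
Proof. by rewrite /quad -scalemxAr -scalemxAl [LHS]mxE. Qed.

Lemma quad_rank1 r v : quad (r *m r^T) v = (v^T *m r) ord0 ord0 ^+ 2.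
Proof.
rewrite /quad mulmxA -mulmxA [LHS]mxE big_ord1 expr2.
by congr (_ * _); rewrite -[r^T *m v]trmxK trmx_mul trmxK [LHS]mxE.
Qed.

Lemma quad_congr (A P : 'M[R]_n) v : quad (A *m P *m A^T) v = quad P (A^T *m v).
Proof. by rewrite /quad trmx_mul trmxK !mulmxA. Qed.

Lemma psdmxD P Q : psdmx P -> psdmx Q -> psdmx (P + Q).
Proof.
move=> [Ps Pp] [Qs Qp]; split=> [|v]; first by rewrite linearD /= Ps Qs.
by rewrite -/(quad _ _) quadD addr_ge0 ?Pp ?Qp.
Qed.

Lemma psdmxZ a P : 0 <= a -> psdmx P -> psdmx (a *: P).
Proof.
move=> a0 [Ps Pp]; split=> [|v]; first by rewrite linearZ /= Ps.
by rewrite -/(quad _ _) quadZ mulr_ge0 ?Pp.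
Qed.

Lemma psdmx_rank1 r : psdmx (r *m r^T).
Proof.
split=> [|v]; first by rewrite trmx_mul trmxK.
by rewrite -/(quad _ _) quad_rank1 sqr_ge0.
Qed.

Lemma psdmx_congr (A P : 'M[R]_n) : psdmx P -> psdmx (A *m P *m A^T).
Proof.
move=> [Ps Pp]; split=> [|v]; first by rewrite !trmx_mul trmxK Ps mulmxA.
by rewrite -/(quad _ _) quad_congr; apply: Pp.
Qed.

Lemma sqrtmxP P : psdmx P -> psdmx (sqrtmx P) /\ sqrtmx P *m sqrtmx P = P.
Proof. by move=> /psd_sqrt_exists; apply: xgetPex. Qed.

Lemma norm2_le1 z : (norm2 z <= 1) = ((z^T *m z) ord0 ord0 <= 1).
Proof.
rewrite /norm2 -[X in _ <= X]sqrtr1 ler_sqrt //; congr (_ <= _).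
by rewrite [RHS]mxE; apply: eq_bigr => i _; rewrite mxE expr2.
Qed.

Lemma sqr_dot_le u z : (z^T *m z) ord0 ord0 <= 1 ->
  (u^T *m z) ord0 ord0 ^+ 2 <= (u^T *m u) ord0 ord0.
Proof.
move=> z1; set t := (u^T *m z) ord0 ord0.
(* |u - t z|^2 >= 0, where |z| <= 1 *)
have : 0 <= \sum_i (u i ord0 - t * z i ord0) ^+ 2.
  by apply: sumr_ge0 => i _; apply: sqr_ge0.
have -> : \sum_i (u i ord0 - t * z i ord0) ^+ 2 =
    (u^T *m u) ord0 ord0 - 2 * t * t + t ^+ 2 * (z^T *m z) ord0 ord0.
  rewrite {3}/t ![(_ *m _) _ _]mxE !mulr_sumr -sumrB -big_split /=.
  by apply: eq_bigr => i _; rewrite !mxE; ring.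
have := sqr_ge0 t; nra.
Qed.

(** The image of a symmetric matrix is the orthogonal complement of its kernel: [x^T] lies in the
    row space of [P] as soon as it kills the columns of [cokermx P], and [P] annihilates each of
    these. *)
Lemma sym_image P x : P^T = P ->
  (forall v, P *m v = 0 -> (v^T *m x) ord0 ord0 = 0) -> exists w, x = P *m w.
Proof.
move=> Ps kerP.
have /submxP[D xD] : (x^T <= P)%MS.
  rewrite submxE; apply/eqP/rowP => j; rewrite [RHS]mxE.
  have : P *m col j (cokermx P) = 0 by rewrite colE mulmxA mulmx_coker mul0mx.
  move/kerP <-; rewrite !mxE; apply: eq_bigr => i _.
  by rewrite !mxE mulrC.
by exists D^T; rewrite -[x]trmxK xD trmx_mul Ps.
Qed.

Lemma ellipsoidP c P x : psdmx P ->
  ellipsoid c P x <-> forall v, (v^T *m (x - c)) ord0 ord0 ^+ 2 <= quad P v.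
Proof.
move=> Ppsd; have [[Ss _] SS] := sqrtmxP Ppsd; set S := sqrtmx P in Ss SS *.
have quadE v : quad P v = ((S *m v)^T *m (S *m v)) ord0 ord0.
  by rewrite /quad -SS trmx_mul Ss !mulmxA.
split=> [[z /= + <-] v|suppx].
  rewrite norm2_le1 (addrC c) addrK quadE -/S => /(sqr_dot_le (S *m v)).
  by rewrite {1}trmx_mul Ss -mulmxA.
(* On the kernel of [P] the bound is 0, which forces [x - c] to be orthogonal to it. *)
have [v Pv0|w xw] := sym_image (x := x - c) (proj1 Ppsd).
  apply/eqP; rewrite -sqrf_eq0 eq_le sqr_ge0 andbT.
  by apply: le_trans (suppx v) _; rewrite /quad -mulmxA Pv0 mulmx0 mxE.
exists (S *m w) => /=; last by rewrite mulmxA SS -xw addrC subrK.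
rewrite norm2_le1 -quadE.
(* With [q = quad P w = |S w|^2], the bound in the direction [w] itself reads [q^2 <= q], so
   [q <= 1]. *)
have := suppx w; rewrite xw mulmxA -/(quad P w).
have := proj2 Ppsd w; rewrite -/(quad P w); nra.
Qed.

End Quad.

(** * One step of the shape recursion and its iteration *)

(** Weighted Young inequality: the gap between the two sides is [(mu a - b)^2 / mu]. *)
Lemma sqr_add_le (R : realType) (mu a b : R) : 0 < mu ->
  (a + b) ^+ 2 <= (1 + mu) * a ^+ 2 + (1 + mu) / mu * b ^+ 2.
Proof.
move=> mu0; rewrite -subr_ge0.
have -> : (1 + mu) * a ^+ 2 + (1 + mu) / mu * b ^+ 2 - (a + b) ^+ 2
    = (mu * a - b) ^+ 2 / mu by field; rewrite gt_eqF.
by rewrite divr_ge0 ?sqr_ge0 ?ltW.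
Qed.

Section PredShape.
Context {R : realType} {n m : nat}.
Variables (P0 : 'M[R]_n) (G : 'M[R]_(n, m)) (sigma : R) (mu : 'cV[R]_m).
Hypotheses (sigma_gt0 : 0 < sigma) (mu_gt0 : forall i : 'I_m, 0 < mu i ord0).
Hypothesis P0_psd : psdmx P0.

Let Pstep := pred_shape P0 G sigma mu.

Lemma pred_shapeS (j : 'I_m) : Pstep j.+1 = (1 + mu j ord0) *: Pstep j
  + ((1 + mu j ord0) / (mu j ord0 * sigma)) *: (col j G *m (col j G)^T).
Proof. by rewrite /Pstep /= valK. Qed.

Lemma psdmx_pred_shape i : psdmx (Pstep i).
Proof.
rewrite /Pstep; elim: i => [//|i IH] /=.
case: insub => [j|//]; have mu0 := mu_gt0 j.
apply: psdmxD; apply: psdmxZ => //; last exact: psdmx_rank1.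
  by rewrite addr_ge0 ?ltW.
by rewrite divr_ge0 ?addr_ge0 ?mulr_ge0 ?ltW.
Qed.

(** The outer factor [sigma] cancels the one in the denominator of the rank-one term, leaving
    exactly the coefficients of [sqr_add_le]. *)
Lemma quad_pred_shapeS (j : 'I_m) v :
  quad (sigma *: Pstep j.+1) v = (1 + mu j ord0) * quad (sigma *: Pstep j) v
    + (1 + mu j ord0) / mu j ord0 * (v^T *m col j G) ord0 ord0 ^+ 2.
Proof.
rewrite pred_shapeS !(quadZ, quadD) quad_rank1; field.
by rewrite !gt_eqF.
Qed.

Lemma ellipsoid_pred_shapeS c (j : 'I_m) :
  ellipsoid c (sigma *: Pstep j) `<=` ellipsoid c (sigma *: Pstep j.+1).
Proof.
have psdi i : psdmx (sigma *: Pstep i).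
  exact: psdmxZ (ltW sigma_gt0) (psdmx_pred_shape i).
move=> y /(ellipsoidP _ _ (psdi _)) suppy; apply/(ellipsoidP _ _ (psdi _)) => v.
apply: le_trans (suppy v) _; rewrite quad_pred_shapeS.
have q_ge0 := proj2 (psdi j) v; rewrite -/(quad _ v) in q_ge0.
have mu0 := mu_gt0 j.
have mu1 : 0 <= 1 + mu j ord0 by rewrite addr_ge0 ?ltW.
rewrite mulrDl mul1r -addrA lerDl.
by apply: addr_ge0; apply: mulr_ge0 => //; rewrite ?sqr_ge0 ?divr_ge0 // ltW.
Qed.

(** Stated for partial sums so that induction adds one noise column at a time; at [i = m] the sum is
    the whole contribution of [G *m nu] in the direction [v]. *)
Lemma sqr_dot_pred_shape (nu : 'cV[R]_m) (v y : 'cV[R]_n) (i : nat) :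
  (forall j, -1 <= nu j ord0 <= 1) -> (i <= m)%N ->
  (v^T *m y) ord0 ord0 ^+ 2 <= quad (sigma *: P0) v ->
  ((v^T *m y) ord0 ord0
     + \sum_(j < m | (j < i)%N) (v^T *m col j G) ord0 ord0 * nu j ord0) ^+ 2
    <= quad (sigma *: Pstep i) v.
Proof.
move=> nu_box + suppy; elim: i => [_|i IH im]; first by rewrite big_pred0 ?addr0.
pose j := Ordinal im; rewrite (bigD1 j) //= addrCA addrC.
rewrite (eq_bigl (fun j0 : 'I_m => (j0 < i)%N)) => [|j0]; last first.
  by rewrite ltnS [RHS]ltn_neqAle andbC.
apply: le_trans (sqr_add_le _ _ (mu_gt0 j)) _.
rewrite (quad_pred_shapeS j) lerD // ler_wpM2l //.
- by rewrite addr_ge0 ?ltW.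
- exact/IH/ltnW.
- by rewrite divr_ge0 ?addr_ge0 ?ltW.
have /andP[nu_ge nu_le] := nu_box j.
(* The box constraint enters only as [nu_j^2 <= 1]. *)
by rewrite exprMn ler_piMr ?sqr_ge0 //; nra.
Qed.

End PredShape.

Theorem theorem3p1 (R : realType) (n m l k : nat)
    (n_gt0 : (0 < n)%N) (m_gt0 : (0 < m)%N) (l_gt0 : (0 < l)%N) (k_gt0 : (0 < k)%N)
    (A : nat -> 'M[R]_n) (B : nat -> 'M[R]_(n, l)) (G : nat -> 'M[R]_(n, m))
    (tau : nat -> 'cV[R]_l) (xhat : nat -> 'cV[R]_n)
    (sigma : nat -> R) (P : nat -> 'M[R]_n)
    (x : nat -> 'cV[R]_n) (nu : nat -> 'cV[R]_m)
    (sigma_gt0 : 0 < sigma k.-1)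
    (P_psd : psdmx (P k.-1))
    (x_prev : x k.-1 \in ellipsoid (xhat k.-1) (sigma k.-1 *: P k.-1))
    (nu_box : forall i : 'I_m, -1 <= nu k.-1 i ord0 <= 1)
    (x_step : x k = A k.-1 *m x k.-1 + B k.-1 *m tau k.-1 + G k.-1 *m nu k.-1) :
  forall mu : 'cV[R]_m, (forall i : 'I_m, 0 < mu i ord0) ->
  let xpred := A k.-1 *m xhat k.-1 + B k.-1 *m tau k.-1 in
  let Pstep := pred_shape (A k.-1 *m P k.-1 *m (A k.-1)^T) (G k.-1)
                          (sigma k.-1) mu in
  let Ppred := Pstep m in
  let Estep := fun i : nat => ellipsoid xpred (sigma k.-1 *: Pstep i) in
  [/\ x k \in ellipsoid xpred (sigma k.-1 *: Ppred),
      ellipsoid xpred (sigma k.-1 *: Ppred) = Estep m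
    & forall i : nat, (i < m)%N -> Estep i `<=` Estep i.+1].
Proof.
move=> mu mu_gt0 xpred Pstep Ppred Estep.
have P0_psd := psdmx_congr (A k.-1) P_psd.
split=> // [|i im]; last first.
  exact: (ellipsoid_pred_shapeS sigma_gt0 mu_gt0 P0_psd (j := Ordinal im)).
rewrite inE; apply/ellipsoidP => [|v].
  exact: psdmxZ (ltW sigma_gt0) (psdmx_pred_shape _ sigma_gt0 mu_gt0 P0_psd m).
move: x_prev; rewrite inE.
(* The direction [A^T v] is chosen because pairing it with [x - xhat] equals pairing [v] with
   [A (x - xhat)], while [quad P (A^T v)] is the quadratic form of [A P A^T] at [v]. *)
move/(ellipsoidP _ _ (psdmxZ (ltW sigma_gt0) P_psd))/(_ ((A k.-1)^T *m v)).
rewrite trmx_mul trmxK -mulmxA -quad_congr -scalemxAr -scalemxAl => suppx.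
have -> : x k - xpred = A k.-1 *m (x k.-1 - xhat k.-1) + G k.-1 *m nu k.-1.
  by rewrite x_step /xpred mulmxBr opprD addrAC addrACA subrr addr0.
have := sqr_dot_pred_shape (G k.-1) sigma_gt0 mu_gt0 nu_box (leqnn m) suppx.
set s := \sum_(_ < m | _) _; suff <- : (v^T *m (G k.-1 *m nu k.-1)) ord0 ord0 = s.
  by rewrite mulmxDr [in X in _ -> X]mxE.
rewrite mulmxA [LHS]mxE; apply: eq_big => [j|j _]; first by rewrite ltn_ord.
by congr (_ * _); rewrite !colE mulmxA -colE [RHS]mxE.
Qed.
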